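(* An infinite cardinal $\kappa$ is greatly inaccessible if and only if $\kappa$ is Mahlo.
   Context: A cardinal is inaccessible if it is an uncountable regular strong limit cardinal. An infinite cardinal $\kappa$ is Mahlo if and only if the set of inaccessible cardinals below $\kappa$ is a stationary subset of $\kappa$. For $X\subseteq\kappa$ let $\mathcal{I}(X)=\{\alpha\in X : \alpha \text{ is an inaccessible cardinal and a limit point of } X\}$. A cardinal $\kappa$ is greatly inaccessible if and only if there is a (proper) filter $F$ on $\kappa$ which is uniform (for every $\beta<\kappa$ the set $[\beta,\kappa)$ is in $F$), normal (closed under diagonal intersections $\Delta_{\alpha<\kappa}X_\alpha=\{\gamma<\kappa : \gamma\in\bigcap_{\alpha<\gamma}X_\alpha\}$), and closed under $\mathcal{I}$ (if $X\in F$ then $\mathcal{I}(X)\in F$). *)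

(* Defs.v *)
From mathcomp Require Import all_boot all_order interval.
From mathcomp Require Import boolp classical_sets cardinality set_interval filter.
From mathcomp Require wochoice.

Set Implicit Arguments.
Unset Strict Implicit.
Unset Printing Implicit Defensive.

Local Open Scope order_scope.
Local Open Scope classical_set_scope.
Local Open Scope card_scope.

(* An infinite cardinal kappa is encoded as a well-ordered type K of order type
   kappa: the elements of K are the ordinals below kappa, and an element a is
   identified, as a von Neumann ordinal, with its initial segment `]-oo, a[.
   Cardinals are initial ordinals, both for elements of K and for K itself. *)

Section Ordinals.
Context {d : Order.disp_t} {K : orderType d}.
Implicit Types (a b c : K) (A C X : set K) (F : set_system K).

Definition seg a : set K := `]-oo, a[%classic.

Definition card_lt {T U : Type} (A : set T) (B : set U) : Prop :=
  A #<= B /\ A #!= B.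

Definition is_cardinal a : Prop := forall b, b < a -> seg b #!= seg a.

Definition cofinal_in A a : Prop :=
  A `<=` seg a /\ forall b, b < a -> exists2 c, A c & b <= c.

(* cf a = a *)
Definition regular a : Prop :=
  [/\ is_cardinal a, infinite_set (seg a)
    & forall A, cofinal_in A a -> A #= seg a].

Definition strong_limit a : Prop :=
  forall b, b < a -> is_cardinal b ->
    card_lt [set A : set K | A `<=` seg b] (seg a).

Definition inaccessible a : Prop :=
  [/\ is_cardinal a, ~ countable (seg a), regular a & strong_limit a].

(* a = sup (X `&` a); nonemptiness only excludes a = 0. *)
Definition limit_point X a : Prop :=
  X `&` seg a !=set0 /\ isLub (X `&` seg a) a.

Definition closed_unbounded C : Prop :=
  (forall a, limit_point C a -> C a) /\ (forall b, exists2 c, C c & b < c).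

Definition stationary X : Prop :=
  forall C, closed_unbounded C -> X `&` C !=set0.

Definition inacc_limits X : set K :=
  [set a | [/\ X a, inaccessible a & limit_point X a]].

Definition diag_inter (X : K -> set K) : set K :=
  [set c | forall a, a < c -> X a c].

Definition uniform F : Prop := forall b, F `[b, +oo[%classic.

Definition normal F : Prop :=
  forall X : K -> set K, (forall a, F (X a)) -> F (diag_inter X).

End Ordinals.

Definition infinite_cardinal {d : Order.disp_t} (K : orderType d) : Prop :=
  [/\ wochoice.well_order (<=%O : rel K), infinite_set [set: K]
    & forall a : K, seg a #!= [set: K]].

Definition mahlo {d : Order.disp_t} (K : orderType d) : Prop :=
  stationary [set a : K | inaccessible a].

Definition greatly_inaccessible {d : Order.disp_t} (K : orderType d) : Prop :=
  exists F : set_system K,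
    [/\ ProperFilter F, uniform F, normal F
      & forall X, F X -> F (inacc_limits X)].

(* Main.v *)
(* For f : seq K -> K, the points of K closed under f contain a club when K is
   regular and uncountable; conversely a stationary set of inaccessibles forces
   K to be regular.  So, if K is Mahlo, the sets containing all inaccessible
   points closed under some f form a proper filter.  Functions of finite
   sequences make normality immediate: K many functions f_a are coded by the
   single function (a :: s) |-> f_a s. *)
Require Import Defs.
From mathcomp Require Import all_boot all_order.
From mathcomp Require Import interval boolp classical_sets functions cardinality.
From mathcomp Require Import set_interval filter.
From mathcomp Require wochoice.

Set Implicit Arguments.
Unset Strict Implicit.
Unset Printing Implicit Defensive.

Import Order.TTheory.

Local Open Scope order_scope.
Local Open Scope classical_set_scope.
Local Open Scope card_scope.

(** Hilbert's hotel: [h] moves [f n] to [f n.+1] and fixes every point outside the range of [f]. *)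
Lemma injective_avoiding (T : Type) (f : nat -> T) : injective f ->
  exists h : T -> T, injective h /\ forall x, h x <> f 0%N.
Proof.
move=> fI.
have /choice[h hP] : forall x, exists y,
    (exists2 n, x = f n & y = f n.+1) \/ ((forall n, x <> f n) /\ y = x).
  move=> x; have [[n xE]|nx] := pselect (exists n, x = f n).
    by exists (f n.+1); left; exists n.
  by exists x; right; split=> // n xE; apply: nx; exists n.
exists h; split=> [x y|x].
  case: (hP x) => [[n -> ->]|[nx ->]]; case: (hP y) => [[p -> ->]|[ny ->]] //.
  - by move=> /fI[->].
  - by move=> yE; case: (ny n.+1).
  - by move=> xE; case: (nx p.+1).
case: (hP x) => [[n _ ->] /fI//|[nx ->]]; exact: nx.
Qed.

Section WellOrder.
Context {d : Order.disp_t} {K : orderType d}.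
Implicit Types (a b c : K) (A C X : set K).

Lemma segE a b : seg a b = (b < a) :> Prop.
Proof. by rewrite /seg /= in_itv. Qed.

Lemma limit_pointP X a : limit_point X a <->
  X `&` seg a !=set0 /\ forall b, b < a -> exists2 c, X c & b < c < a.
Proof.
split=> -[X0 Xa]; split=> //.
  move=> b ba; apply: contrapT => noc.
  have /(proj2 Xa) : ubound (X `&` seg a) b.
    move=> c [Xc]; rewrite segE => ca; rewrite leNgt; apply/negP => bc.
    by apply: noc; exists c => //; rewrite bc.
  by rewrite leNgt ba.
split=> [c [_]|b ub]; first by rewrite segE => /ltW.
rewrite leNgt; apply/negP => /Xa[c Xc /andP[bc ca]].
have /ub : (X `&` seg a) c by split; rewrite ?segE.
by rewrite leNgt bc.
Qed.

Hypothesis wo : wochoice.well_order (<=%O : rel K).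

Lemma well_order_min A : A !=set0 -> exists2 a, A a & forall b, A b -> a <= b.
Proof.
move=> [x Ax]; have : wochoice.nonempty [pred y | `[< A y >]].
  by exists x; apply/asboolP.
move=> /wo[z [[/asboolP Az zmin] _]]; exists z => // b Ab.
by apply: zmin; apply/asboolP.
Qed.

Section Unbounded.
Hypothesis nomax : forall b, exists c, b < c.

Lemma exists_succ a : exists2 b, a < b & forall c, a < c -> b <= c.
Proof. exact: well_order_min (nomax a). Qed.

Lemma closed_unboundedT : closed_unbounded [set: K].
Proof. by split=> // b; have [c bc] := nomax b; exists c. Qed.

(* [C] is the part above [a] of the closure of the set of successors of elements
   of [A]; an inaccessible in [C] would have a cofinal subset of size at most
   [a]. *)
Lemma small_bounded A a : mahlo K -> A #<= seg a ->
  exists b, forall x, A x -> x < b.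
Proof.
move=> mK Aa; apply: contrapT => Aub.
have {}Aub b : exists2 x, A x & b <= x.
  apply: contrapT => nx; apply: Aub; exists b => x Ax.
  by rewrite ltNge; apply/negP => bx; apply: nx; exists x.
pose C := [set c | a < c /\ cofinal_in (A `&` seg c) c].
have [] := mK C; last first.
  move=> c [[card_c _ [_ _ reg_c] _] [ac /reg_c Ac]].
  have /negP := card_c _ ac; apply; rewrite card_eq_le; apply/andP; split.
    apply: subset_card_le => x; rewrite !segE => xa; exact: lt_trans ac.
  rewrite -(card_le_eql Ac); apply: card_le_trans Aa.
  exact: subset_card_le.
split=> [c /limit_pointP[[x [[ax _]]]]|b].
  rewrite segE => xc climC; split; first exact: lt_trans xc.
  split=> // b /climC[y [_ [_ yC]] /andP[/yC[z [Az]]]].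
  rewrite segE => zy bz yc; exists z => //; split=> //.
  by rewrite segE; exact: lt_trans yc.
have [x Ax] := Aub (Order.max a b); rewrite ge_max => /andP[ax bx].
have [c xc cmin] := exists_succ x; exists c; last exact: le_lt_trans xc.
split; first exact: le_lt_trans xc.
split=> // y yc; exists x; first by split; rewrite ?segE.
by rewrite leNgt; apply/negP => /cmin; rewrite leNgt yc.
Qed.

(** The segment below any one inaccessible is infinite, hence at least as large as the range of
    [g]. *)
Lemma countable_bounded (g : nat -> K) : mahlo K ->
  exists b, forall n, g n < b.
Proof.
move=> mK; have [c [[_ _ [_ /infiniteP infc _] _] _]] := mK _ closed_unboundedT.
have [|b gb] := @small_bounded (range g) c mK.
  exact: card_le_trans (card_image_le _ _) infc.
by exists b => n; apply: gb; exists n.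
Qed.

Lemma seq_bounded (f : seq K -> K) a : mahlo K ->
  exists b, forall s, all (< a) s -> f s < b.
Proof.
(* Induction on the length: with the head [x] fixed, the values are bounded by some [g x], and only
   the [x] in [seg a] occur. The countably many lengths are joined at the end. *)
move=> mK; have fn n : exists b, forall s, size s = n -> all (< a) s -> f s < b.
  elim: n f => [|n IHn] f.
    have [b fb] := nomax (f [::]).
    by exists b => s /size0nil ->.
  have /choice[g gP] := fun x => IHn (fun s => f (x :: s)).
  have [b gb] := small_bounded mK (card_image_le g (seg a)).
  exists b => -[//|x s] [sn] /= /andP[xa sa].
  by apply: lt_trans (gP x s sn sa) (gb _ _); exists x.
have [g gP] := choice fn; have [b gb] := countable_bounded g mK.
by exists b => s sa; apply: lt_trans (gb (size s)); exact: gP.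
Qed.

(** The empty sequence counts, so closure includes [f [::] < a]: a function can impose a lower bound
    on its closed points. *)
Definition closed_under (f : seq K -> K) a := forall s, all (< a) s -> f s < a.

(** The entries of [s] are passed one at a time, each time moving to a larger element of [P]; the
    first hypothesis starts the induction at the empty sequence. *)
Lemma seq_cofinal_bound (P : K -> Prop) s c : (exists2 b, P b & b < c) ->
  (forall b, b < c -> exists2 y, P y & b < y < c) -> all (< c) s ->
  exists2 y, P y & (y < c) && all (< y) s.
Proof.
move=> P0 Pc; elim: s => [_|x s IHs] /=.
  by have [b Pb bc] := P0; exists b; rewrite ?bc.
move=> /andP[xc /IHs[y Py /andP[yc sy]]].
have [z Pz /andP[]] := Pc (Order.max x y) (ltac:(by rewrite gt_max xc)).
rewrite gt_max => /andP[xz yz] zc; exists z => //; rewrite zc xz /=.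
by apply: sub_all sy => w wy; exact: lt_trans yz.
Qed.

Lemma closed_unbounded_closed_under f : mahlo K ->
  closed_unbounded (closed_under f).
Proof.
move=> mK; split=> [c /limit_pointP[[x [fx]]]|b].
  rewrite segE => xc fc s /(@seq_cofinal_bound (closed_under f)) [||y fy].
  - by exists x.
  - exact: fc.
  - by move=> /andP[yc /fy]; move=> /lt_trans; apply.
have /choice[h hP] : forall a, exists e,
    a < e /\ forall s, all (< a) s -> f s < e.
  move=> a; have [e fe] := @seq_bounded f a mK; have [e' ae'] := nomax a.
  exists (Order.max e e'); split; first by rewrite lt_max ae' orbT.
  by move=> s /fe fs; rewrite lt_max fs.
(* The least strict upper bound [c] of the iterates is closed: a finite sequence below [c] lies
   below some [u n], so its value is below [u n.+1]. *)
pose u n := iter n h b.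
have ub := countable_bounded u mK.
have [c uc cmin] := @well_order_min [set c | forall n, u n < c] ub.
exists c; last exact: uc 0%N.
move=> s /(@seq_cofinal_bound (range u))[||y [n _ <-]].
- by exists b; [exists 0%N|exact: uc 0%N].
- move=> x xc; apply: contrapT => nx.
  suff /cmin : forall n, u n < x by rewrite leNgt xc.
  move=> n; rewrite ltNge; apply/negP => xn; apply: nx.
  exists (u n.+1); first by exists n.+1.
  by rewrite uc andbT; apply: le_lt_trans xn _; exact: (hP (u n)).1.
- move=> /andP[_ /(proj2 (hP (u n)))/lt_trans]; apply; exact: uc n.+1.
Qed.

Definition closure_filter : set_system K :=
  [set X | exists f, forall c, inaccessible c -> closed_under f c -> X c].

(** Taking the maximum with the constant [a] pushes every closed point above [a]. This serves both
    properness and the limit points below. *)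
Lemma closure_filter_unbounded X a : mahlo K -> closure_filter X ->
  exists2 c, X c & a < c.
Proof.
move=> mK [f fX].
have [c [ic cc]] := mK _ (closed_unbounded_closed_under
  (fun s => Order.max (f s) a) mK).
exists c; last by have := cc [::] isT; rewrite gt_max => /andP[].
by apply: fX => // s /cc; rewrite gt_max => /andP[].
Qed.

Lemma mahlo_greatly_inaccessible a0 : mahlo K -> greatly_inaccessible K.
Proof.
move=> mK; exists closure_filter; split.
- split; first by move=> /(closure_filter_unbounded a0 mK)[].
  split=> [|X Y [f fX] [g gY]|X Y XY [f fX]].
  + by exists (fun=> a0).
  + exists (fun s => Order.max (f s) (g s)) => c ic cc.
    by split; [apply: fX|apply: gY] => // s /cc; rewrite gt_max => /andP[].
  + by exists f => c ic /(fX _ ic)/XY.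
- move=> b; exists (fun=> b) => c _ /(_ [::] isT) bc.
  by rewrite /= in_itv /= andbT ltW.
- move=> X /choice[f fX].
  (* The value [a0] at [[::]] is an arbitrary default; it can only remove closed points. *)
  exists (fun s => if s is a :: t then f a t else a0) => c ic cc a ac.
  by apply: fX => // s sc; apply: (cc (a :: s)); rewrite /= ac.
- move=> X FX; have [f fX] := FX.
  have /choice[g gP] : forall a, exists c, X c /\ a < c.
    by move=> a; have [c] := closure_filter_unbounded a mK FX; exists c.
  (* Singletons [[:: b]] make [X] cofinal below [c]; at [[::]] the default head puts [g a0] below
     [c], so [X] meets [seg c]. *)
  exists (fun s => Order.max (f s) (g (head a0 s))) => c ic cc.
  split=> //; first by apply: fX => // s /cc; rewrite gt_max => /andP[].
  apply/limit_pointP; split.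
    exists (g a0); split; first exact: (gP a0).1.
    by have := cc [::] isT; rewrite segE gt_max => /andP[].
  move=> b bc; exists (g b); first exact: (gP b).1.
  rewrite (gP b).2 /=; have := cc [:: b]; rewrite /= bc gt_max.
  by move=> /(_ isT)/andP[].
Qed.

End Unbounded.
End WellOrder.

(** An infinite set absorbs one point, so a maximum [b] would make [seg b] equipotent to [K]. *)
Lemma infinite_cardinal_nomax (d : Order.disp_t) (K : orderType d) :
  infinite_cardinal K -> forall b : K, exists c, b < c.
Proof.
move=> [_ infK cardK] b; apply: contrapT => bmax.
have ltb x : x != b -> x < b.
  move=> xb; rewrite lt_neqAle xb leNgt; apply/negP => bx.
  by apply: bmax; exists x.
have /infiniteP/card_leP[f] : infinite_set (seg b).
  apply: sub_infinite_set (infinite_setD infK (finite_set1 b)) => x [_ /eqP xb].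
  by rewrite segE ltb.
(* [f'] lists [b], then a sequence in [seg b]; shifting along it embeds [K] into [seg b]. *)
pose f' n := if n is m.+1 then val (f (SigSub (mem_setT m))) else b.
have fb m : f' m.+1 < b.
  by have := set_valP (f (SigSub (mem_setT m))); rewrite segE.
have f'I : injective f'.
  move=> [|m] [|n] //.
  - by move=> bE; have := fb n; rewrite -bE ltxx.
  - by move=> bE; have := fb m; rewrite bE ltxx.
  - by move=> /val_inj /(inj (mem_setT _) (mem_setT _)) [->].
have [h [hI hb]] := injective_avoiding f'I.
have /negP := cardK b; apply; rewrite card_eq_le card_leT /=.
rewrite -(card_le_eql (inj_card_eq (in2W hI))).
by apply: subset_card_le => _ [x _ <-]; rewrite segE ltb //; apply/eqP/hb.
Qed.

(* Below, [f a] is an element of the club [C] above [a]: the points [c] with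
   [f a <= c] for all [a < c] are limits of [C] or belong to [C]. *)
Lemma greatly_inaccessible_mahlo (d : Order.disp_t) (K : orderType d) :
  greatly_inaccessible K -> mahlo K.
Proof.
move=> [F [PF uF nF IF]] C [closedC unbC].
have /choice[f fP] : forall a, exists c, C c /\ a < c.
  by move=> a; have [c] := unbC a; exists c.
have FD := nF _ (fun a => uF (f a)).
(* Besides inaccessibility, this gives some [x] below [c], needed for [C] to meet [seg c]. *)
have FI : F (inacc_limits setT) by apply: IF; exact: filterT.
have [c [fc [_ ic /limit_pointP[[x [_ xc]] _]]]] := filter_ex (filterI FD FI).
exists c; split=> //; apply: contrapT => nCc; apply: (nCc).
have {}fc a : a < c -> f a < c.
  move=> /fc; rewrite /= in_itv /= andbT le_eqVlt => /predU1P[fac|//].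
  by case: nCc; rewrite -fac; exact: (fP a).1.
rewrite segE in xc; apply/closedC/limit_pointP; split.
  by exists (f x); split; [exact: (fP x).1|rewrite segE fc].
by move=> b bc; exists (f b); [exact: (fP b).1|rewrite (fP b).2 fc].
Qed.

Theorem theorem10 (d : Order.disp_t) (K : orderType d)
  (hK : infinite_cardinal K) : greatly_inaccessible K <-> mahlo K.
Proof.
split; first exact: greatly_inaccessible_mahlo.
have [wo infK _] := hK; have [a0 _] := infinite_setN0 infK.
exact: (mahlo_greatly_inaccessible wo (infinite_cardinal_nomax hK) a0).
Qed.
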